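(* Let $\Omega$ be a region of $\mathbb{C}$ and let $F:\Omega\to\mathbb{M}_n$ be analytic. Suppose that for each $k=1,\ldots,n$ the function $z\mapsto s_k(F(z))$ attains its maximum value on $\Omega$ (at some point $z_k\in\Omega$, possibly different for different $k$). Then $F$ is constant on $\Omega$.
   Context: A region is a nonempty open connected subset of $\mathbb{C}$. $\mathbb{M}_n$ is the set of $n\times n$ complex matrices; $F$ is analytic if each entry is analytic. For $A\in\mathbb{M}_n$, the singular values $s_1(A)\geq s_2(A)\geq\cdots\geq s_n(A)\geq 0$ are the nonnegative square roots of the eigenvalues of $A^*A$, listed in nonincreasing order. *)

(* Defs.v *)
From HB Require Import structures.
From mathcomp Require Import all_boot all_order all_algebra.
From mathcomp Require Import all_classical all_reals all_analysis.
From mathcomp Require Import complex.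
Set Implicit Arguments. Unset Strict Implicit. Unset Printing Implicit Defensive.
Import Order.TTheory GRing.Theory Num.Theory.
Import numFieldNormedType.Exports.
Local Open Scope ring_scope.
Local Open Scope classical_set_scope.

(* The complex plane C = R[i] (R a real number field), equipped with its
   canonical (norm-induced) topology as a numFieldType. *)
Definition CC (R : realType) : Type := (R[i])^o.

Definition region (R : realType) (O : set (CC R)) : Prop :=
  [/\ open O, connected O & O !=set0].

Definition analytic_on (R : realType) (O : set (CC R)) (f : CC R -> CC R) : Prop :=
  forall z0, O z0 ->
    exists r : R, 0 < r /\
      exists a : nat -> CC R,
        forall z : CC R, `|z - z0| < r%:C%C ->
          series (fun k => a k * (z - z0) ^+ k) @ \oo --> f z.

Definition mx_analytic_on (R : realType) (n : nat) (O : set (CC R))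
    (F : CC R -> 'M[CC R]_n) : Prop :=
  forall i j : 'I_n, analytic_on O (fun z => F z i j).

Definition adjmx (R : realType) (n : nat) (A : 'M[R[i]]_n) : 'M[R[i]]_n :=
  map_mx (@conjc R) A^T.

(* The eigenvalues of a square complex matrix, listed with algebraic
   multiplicity: a sequence rs with char_poly B = \prod_(x <- rs) ('X - x).
   (Such a sequence exists since C is algebraically closed and char_poly B
   is monic; it is unique up to permutation.) *)
Definition eigenvalues_seq (R : realType) (n : nat) (B : 'M[R[i]]_n)
    : seq R[i] :=
  xget [::] [set rs : seq R[i] |
              char_poly B = \prod_(x <- rs) ('X - x%:P)].

(* Singular values of A : s_1 >= s_2 >= ... >= s_n >= 0, the nonnegative
   square roots of the eigenvalues of A^* A (which are real and nonnegative),
   listed in nonincreasing order.  [sing_val A k] is s_{k+1}(A) for k : 'I_n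
   (0-indexed). *)
Definition sing_vals (R : realType) (n : nat) (A : 'M[R[i]]_n) : seq R :=
  map (fun x => Num.sqrt x)
      (sort (fun x y : R => y <= x)
            (map (@complex.Re R) (eigenvalues_seq (adjmx A *m A)))).

Definition sing_val (R : realType) (n : nat) (A : 'M[R[i]]_n) (k : 'I_n) : R :=
  nth 0 (sing_vals A) k.

(* Main.v *)
Require Import Defs.
From HB Require Import structures.
From mathcomp Require Import all_boot all_order all_algebra.
From mathcomp Require Import all_classical all_reals all_analysis.
From mathcomp Require Import complex.
Set Implicit Arguments. Unset Strict Implicit. Unset Printing Implicit Defensive.
Import Order.TTheory GRing.Theory Num.Theory.
Import numFieldNormedType.Exports.
Local Open Scope ring_scope.
Local Open Scope classical_set_scope.
Local Open Scope sesquilinear_scope.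

(** Induction on [n].  Write [c] for the maximum of [s_1 o F], attained at [z1],
    and choose unitary [P], [Q] such that the top left entry of [P F(z1) Q] is
    [c].  That entry of [P F(z) Q] is analytic in [z] and bounded in modulus by
    [s_1(F z) <= c], so by the maximum modulus principle it is constantly [c].
    As no row or column of [P F(z) Q] has norm larger than [s_1(F z) = c], the
    matrix is block diagonal, [diag(c, G(z))].  The singular values of [G] are
    [s_2(F), ..., s_n(F)], so [G] is constant by induction. *)

(** * Power series: remainder estimate and local maximum modulus *)

Section PowerSeries.
Variable R : realType.
Local Notation C := (CC R).

Lemma sum_geometric_le2 (q : C) (n : nat) :
  0 <= q -> q <= 2^-1 -> \sum_(k < n) q ^+ k <= 2.
Proof.
(* The extra term makes the induction go through: [q <= 1/2] gives [q^n + 2 q^(n+1) <= 2 q^n], so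
   the left side never increases with [n]. *)
move=> q0 q2; suff : \sum_(k < n) q ^+ k + q ^+ n *+ 2 <= 2.
  by apply: le_trans; rewrite lerDl mulrn_wge0 // exprn_ge0.
elim: n => [|n IHn]; first by rewrite big_ord0 expr0 add0r.
apply: le_trans IHn; rewrite big_ord_recr /= -addrA lerD2l.
rewrite [leRHS]mulr2n lerD2l exprS -mulrnAl ler_piMl ?exprn_ge0 //.
by rewrite -mulr_natr -ler_pdivlMr ?mul1r.
Qed.

(** Convergence at [r / 2] bounds the terms there, so closer to the center the tail is dominated by
    a geometric series. This estimate stands in for differentiation: it yields the value at the
    center, continuity, and the comparison of leading terms. *)
Lemma power_series_remainder (a : nat -> C) (f : C -> C) (r : C) : 0 < r ->
  (forall w : C, `|w| < r -> series (fun k => a k * w ^+ k) @ \oo --> f w) ->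
  exists rho M : C, [/\ 0 < rho, rho < r, 0 <= M &
    forall m w, `|w| <= rho ->
      `|f w - \sum_(k < m) a k * w ^+ k| <= M * (`|w| / rho) ^+ m].
Proof.
move=> r0 fE.
have r20 : 0 < r / 2 by rewrite divr_gt0.
have rlt : `|r / 2| < r.
  by rewrite gtr0_norm // ltr_pdivrMr // ltr_pMr // ltr1n.
have [B B0 aB] : exists2 B : C, 0 <= B & forall k, `|a k * (r / 2) ^+ k| <= B.
  have /cvgP/cvg_seq_bounded := fE _ rlt.
  move=> [B1 [_ SB1]]; pose B := B1 + 1.
  have {SB1} SB k : `|series (fun k => a k * (r / 2) ^+ k) k| <= B.
    by apply: SB1; rewrite // /B ltrDl.
  have Bge0 : 0 <= B by have := SB 0%N; apply: le_trans; exact: normr_ge0.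
  exists (B + B); first by rewrite addr_ge0.
  (* Each term is the difference of two consecutive partial sums, both bounded by [B]. *)
  move=> k; rewrite -[a k * _](addrK (series (fun k => a k * (r / 2) ^+ k) k)).
  apply: le_trans (ler_normB _ _) _.
  by rewrite lerD // addrC -seriesSr.
(* For [|w| <= rho] the ratio [q = |w| / (r / 2)] is at most 1/2, so the geometric sums stay below
   2. *)
pose rho : C := r / 2 / 2.
have rho0 : 0 < rho by rewrite divr_gt0.
have rho_lt : rho < r.
  rewrite (lt_le_trans (_ : _ < r / 2)) //.
    by rewrite ltr_pdivrMr // ltr_pMr // ltr1n.
  by rewrite ler_pdivrMr // ler_pMr // ler1n.
exists rho, (B * 2); split => //; first by rewrite mulr_ge0.
move=> m w wrho; pose q := `|w| / (r / 2).
have q0 : 0 <= q by rewrite divr_ge0 // ltW.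
have q2 : q <= 2^-1 by rewrite ler_pdivrMr // mulrC.
have qrho : q <= `|w| / rho.
  rewrite ler_wpM2l // lef_pV2 ?posrE // ler_pdivrMr // ler_pMr // ler1n //.
have partial N : `|\sum_(m <= k < m + N) a k * w ^+ k| <= B * 2 * (`|w| / rho) ^+ m.
  rewrite -{1}[m]add0n [(m + N)%N]addnC big_addn addnK big_mkord.
  apply: le_trans (ler_norm_sum _ _ _) _.
  have term (k : 'I_N) : `|a (k + m)%N * w ^+ (k + m)| <= B * q ^+ m * q ^+ k.
    rewrite -mulrA -exprD addnC; set j := (m + k)%N.
    rewrite /q expr_div_n normrM normrX [leRHS]mulrCA [leRHS]mulrC.
    rewrite ler_wpM2r ?exprn_ge0 //.
    have := aB j; rewrite normrM normrX (gtr0_norm r20).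
    by rewrite ler_pdivlMr // exprn_gt0.
  apply: le_trans (ler_sum _ (fun k _ => term k)) _.
  rewrite -mulr_sumr mulrAC -!mulrA ler_wpM2l // ler_pM ?exprn_ge0 //.
  - by apply: sumr_ge0 => k _; rewrite exprn_ge0.
  - exact: sum_geometric_le2.
  - by rewrite lerXn2r // nnegrE (le_trans q0).
(* The bound on finite tails passes to the limit: [f w] is within [e] of a partial sum of length
   [m + N]. *)
apply/ler_addgt0Pr => e e0.
have /cvgrPdist_le/(_ _ e0) [N _ SN] := fE _ (le_lt_trans wrho rho_lt).
have := SN (m + N)%N (leq_addl _ _); rewrite /series /= => fS.
rewrite -[f w](subrK (\sum_(0 <= k < m + N) a k * w ^+ k)) -addrA addrC.
apply: le_trans (ler_normD _ _) _; rewrite lerD //.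
rewrite (big_cat_nat (leq0n m) (leq_addr N m)) /= big_mkord addrC addKr.
exact: partial.
Qed.

(** The remainder bound of order 1 vanishes at [w = 0]. *)
Lemma power_series_center (a : nat -> C) (f : C -> C) (r : C) : 0 < r ->
  (forall w : C, `|w| < r -> series (fun k => a k * w ^+ k) @ \oo --> f w) ->
  f 0 = a 0%N.
Proof.
move=> r0 fE; have [rho [M [rho0 _ _ /(_ 1%N 0)]]] := power_series_remainder r0 fE.
rewrite normr0 (ltW rho0) => /(_ isT).
rewrite big_ord1 expr0 mulr1 mul0r expr1 mulr0 normr_le0 subr_eq0.
by move/eqP.
Qed.

(* If a_m is the first nonzero coefficient after a_0 <> 0, moving from the
   center along w = t z with z^m = a_0 / a_m increases |f| by |a_0| t^m to leading order. *)
Lemma power_series_max_modulus (a : nat -> C) (f : C -> C) (r : C) : 0 < r ->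
  (forall w : C, `|w| < r -> series (fun k => a k * w ^+ k) @ \oo --> f w) ->
  (forall w : C, `|w| < r -> `|f w| <= `|f 0|) ->
  forall w : C, `|w| < r -> f w = f 0.
Proof.
move=> r0 fE fmax w wr; have f0 := power_series_center r0 fE.
have [a00|a0N0] := eqVneq (a 0%N) 0.
  apply/eqP; have := fmax _ wr.
  by rewrite f0 a00 normr0 normr_le0.
have [aex|anex] := pselect (exists k, (0 < k)%N && (a k != 0)); last first.
  have a0 k : (0 < k)%N -> a k = 0.
    move=> k0; apply: contrapT => /eqP ak; apply: anex.
    by exists k; rewrite k0.
  rewrite f0; apply: (cvg_unique (@norm_hausdorff _ C) (fE _ wr)).
  apply: cvg_near_cst; exists 1%N => // -[//|n] _ /=.
  rewrite /series /= big_nat_recl // big1 ?expr0 ?mulr1 ?addr0 // => i _.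
  by rewrite a0 ?mul0r.
exfalso; have [m /andP[m0 amN0] mmin] := ex_minnP aex.
(* By minimality of [m], the coefficients strictly between 0 and [m] vanish. *)
have suma0 u : \sum_(k < m) a k * u ^+ k = a 0%N.
  case: m m0 mmin {amN0} => // m _ mmin.
  rewrite big_ord_recl expr0 mulr1 big1 ?addr0 // => i _.
  have [->|ai] := eqVneq (a (lift ord0 i)) 0; first by rewrite mul0r.
  have := mmin (lift ord0 i); rewrite ai /= => /(_ isT).
  by rewrite /bump /= add1n ltnS leqNgt ltn_ord.
have [rho [M [rho0 rho_lt M0 rem]]] := power_series_remainder r0 fE.
pose z : C := m.-root (a 0%N / a m).
have zm : z ^+ m = a 0%N / a m by exact: rootCK.
have zN0 : z != 0.
  apply/negP => /eqP z0; have /eqP := zm.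
  by rewrite z0 expr0n eqn0Ngt m0 /= eq_sym mulf_eq0 invr_eq0 (negbTE a0N0) (negbTE amN0).
have z_gt0 : 0 < `|z| by rewrite normr_gt0.
have a0_gt0 : 0 < `|a 0%N| by rewrite normr_gt0.
pose L := M * (`|z| / rho) ^+ m.+1.
have L0 : 0 <= L by rewrite mulr_ge0 // exprn_ge0 // divr_ge0 // ltW.
(* Inverting a sum meets two constraints at once: [t |z| <= rho], so that the remainder estimate
   applies, and [2 t L <= |a 0|]. *)
pose t := (`|z| / rho + L * 2 / `|a 0%N|)^-1.
have D0 : 0 < `|z| / rho + L * 2 / `|a 0%N|.
  by rewrite ltr_pwDl ?divr_gt0 // divr_ge0 // mulr_ge0.
have t0 : 0 < t by rewrite invr_gt0.
have tnorm : `|t * z| = t * `|z| by rewrite normrM gtr0_norm.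
have trho : `|t * z| <= rho.
  rewrite tnorm mulrC ler_pdivrMr // mulrDr mulrCA divff ?gt_eqF // mulr1.
  by rewrite lerDl mulr_ge0 ?(ltW rho0) // divr_ge0 // mulr_ge0.
have := rem m.+1 _ trho.
rewrite big_ord_recr /= exprMn zm [a m * _]mulrCA.
rewrite [a m * _]mulrCA divff // mulr1.
rewrite suma0 tnorm -[t * _ / _]mulrA exprMn [M * _]mulrCA -/L distrC => ft.
(* The degree [m] term at [t * z] is [t^m * a 0], a positive multiple of [a 0], so the moduli add.
   Maximality bounds [|f (t * z)|] by [|a 0|], and the remainder is at most [t^(m+1) * L]. *)
have : `|a 0%N| + t ^+ m * `|a 0%N| <= `|a 0%N| + t ^+ m.+1 * L.
  have -> : `|a 0%N| + t ^+ m * `|a 0%N| = `|a 0%N + t ^+ m * a 0%N|.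
    rewrite -[X in X + _ * _]mul1r -[X in `|X + _|]mul1r -!mulrDl normrM.
    by rewrite (gtr0_norm (_ : 0 < 1 + _)) // ltr_pwDl // exprn_ge0 // ltW.
  rewrite -[X in `|X|](subrK (f (t * z))) addrC.
  apply: le_trans (ler_normD _ _) _; rewrite lerD // -f0.
  by apply: fmax; apply: le_lt_trans trho rho_lt.
rewrite lerD2l exprSr -mulrA ler_pM2l ?exprn_gt0 // => aL.
(* Together with [|a 0| <= t L] this gives [2 t L <= t L] with [t L > 0], a contradiction. *)
have : t * (L * 2 / `|a 0%N|) <= 1.
  rewrite mulrC ler_pdivrMr // mul1r.
  by rewrite lerDr divr_ge0 // ltW.
rewrite mulrA ler_pdivrMr // mul1r mulrA => La.
have := le_trans La aL.
by rewrite ger_pMr ?(lt_le_trans a0_gt0 aL) // lern1.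
Qed.

End PowerSeries.

(** * Analytic functions and the maximum modulus principle *)

Section Analytic.
Variable R : realType.
Local Notation C := (CC R).
Implicit Types (O : set C) (f g : C -> C).

Lemma near_dist_lt (z0 d : C) : 0 < d -> \forall z \near z0, `|z - z0| < d.
Proof.
move=> d0; apply: filterS (@nbhsx_ballx _ C z0 d d0) => z.
by rewrite -ball_normE /= distrC.
Qed.

(** Moves the center to 0 and the radius into [C], the form in which the power series lemmas are
    stated. *)
Lemma analytic_onP O f z0 : analytic_on O f -> O z0 ->
  exists2 r : C, 0 < r & exists a : nat -> C, forall w : C, `|w| < r ->
    series (fun k => a k * w ^+ k) @ \oo --> f (w + z0).
Proof.
move=> /[apply] -[r [r0 [a fE]]]; exists r%:C%C; first by rewrite ltcR.
by exists a => w wr; have := fE (w + z0); rewrite addrK; exact.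
Qed.

(** Continuity, from the remainder of order 1: [|f z - f z0| <= M |z - z0| / rho] near [z0]. *)
Lemma analytic_on_near_lt O f z0 : analytic_on O f -> O z0 ->
  forall e : C, 0 < e -> \forall z \near z0, `|f z - f z0| < e.
Proof.
move=> fO Oz0 e e0; have [r r0 [a fE]] := analytic_onP fO Oz0.
have [rho [M [rho0 _ M0 rem]]] := power_series_remainder r0 fE.
have f0 := power_series_center r0 fE; rewrite add0r in f0.
pose X := (M + 1) / (e * rho).
have X0 : 0 < X by rewrite divr_gt0 ?mulr_gt0 // ltr_wpDl.
have rhoV0 : 0 < rho^-1 by rewrite invr_gt0.
have D0 : 0 < X + rho^-1 by rewrite addr_gt0.
(* The condition [d * X <= 1] amounts to [(M + 1) * d / rho <= e]; [M + 1] replaces [M] to have a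
   positive factor. *)
have [d [d0 d_rho dX]] : exists d : C, [/\ 0 < d, d <= rho & d * X <= 1].
  exists (X + rho^-1)^-1; rewrite invr_gt0; split => //.
    by rewrite invf_ple ?posrE // lerDr ltW.
  by rewrite mulrC ler_pdivrMr // mul1r lerDl ltW.
have d_e : (M + 1) * (d / rho) <= e.
  have -> : (M + 1) * (d / rho) = d * X * e.
    rewrite /X invfM [in RHS]mulrA -![in RHS]mulrA [rho^-1 * e]mulrC (mulrA e^-1).
    by rewrite mulVf ?gt_eqF // mul1r mulrCA.
  by rewrite ler_piMl // ltW.
apply: filterS (near_dist_lt z0 d0) => z zd.
have := rem 1%N (z - z0); rewrite subrK big_ord1 expr0 mulr1 -f0 expr1.
move=> /(_ (le_trans (ltW zd) d_rho)) fz; apply: le_lt_trans fz _.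
apply: lt_le_trans d_e; apply: (@le_lt_trans _ _ ((M + 1) * (`|z - z0| / rho))).
  by rewrite ler_wpM2r ?lerDl // divr_ge0 // ltW.
by rewrite ltr_pM2l ?ltr_wpDl // ltr_pM2r ?invr_gt0.
Qed.

Lemma analytic_on_cst0 O : analytic_on O (fun=> 0).
Proof.
move=> z0 _; exists 1; split=> //; exists (fun=> 0) => z _.
apply: cvg_near_cst; apply: nearW => n; rewrite /series /=.
by rewrite big1 // => i _; rewrite mul0r.
Qed.

Lemma analytic_on_scale O f (c : C) :
  analytic_on O f -> analytic_on O (fun z => c * f z).
Proof.
move=> fO z0 /fO [r [r0 [a fE]]]; exists r; split=> //.
exists (fun k => c * a k) => z /fE fz.
have -> : series (fun k => c * a k * (z - z0) ^+ k) =
          (fun n => c *: (series (fun k => a k * (z - z0) ^+ k) n : C)).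
  apply/funext => n; rewrite /series /= scaler_sumr.
  by apply: eq_bigr => i _; rewrite -mulrA.
exact: cvgZr.
Qed.

Lemma analytic_on_add O f g :
  analytic_on O f -> analytic_on O g -> analytic_on O (fun z => f z + g z).
Proof.
move=> fO gO z0 Oz0; have [r [r0 [a fE]]] := fO _ Oz0.
have [s [s0 [b gE]]] := gO _ Oz0.
exists (Num.min r s); split; first by rewrite lt_min r0.
exists (fun k => a k + b k) => z zrs.
have -> : series (fun k => (a k + b k) * (z - z0) ^+ k) =
   series (fun k => a k * (z - z0) ^+ k) \+ series (fun k => b k * (z - z0) ^+ k).
  apply/funext => n; rewrite /series /= -big_split.
  by apply: eq_bigr => i _; rewrite mulrDl.
apply: cvgD.
- by apply: fE; rewrite (lt_le_trans zrs) // lecR ge_min lexx.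
- by apply: gE; rewrite (lt_le_trans zrs) // lecR ge_min lexx orbT.
Qed.

Lemma analytic_on_sum O (I : Type) (s : seq I) (P : pred I) (f : I -> C -> C) :
  (forall i, analytic_on O (f i)) ->
  analytic_on O (fun z => \sum_(i <- s | P i) f i z).
Proof.
move=> fO; elim: s => [|i s IHs].
  by under eq_fun do rewrite big_nil; exact: analytic_on_cst0.
under eq_fun do rewrite big_cons.
case: (P i); [exact: (analytic_on_add (fO i) IHs) | exact: IHs].
Qed.

(** The set where [f] equals [f z0] is nonempty, open and closed relative to the connected set [O],
    hence all of [O]. *)
Lemma max_modulus_principle O f z0 : region O -> analytic_on O f -> O z0 ->
  (forall z, O z -> `|f z| <= `|f z0|) -> forall z, O z -> f z = f z0.
Proof.
move=> [Oo Oc _] fO Oz0 fmax.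
pose B := O `&` [set z | f z = f z0].
suff BO : B = O by move=> z; rewrite -{1}BO => -[].
apply: Oc; first by exists z0.
(* Open: at a point of [B] the modulus is again maximal, so [f] is constant on a disc around it
   inside [O]. *)
- exists B; last by rewrite setIA setIid.
  rewrite openE => z1 [Oz1 /= fz1].
  have [r r0 [a fE]] := analytic_onP fO Oz1.
  have /nbhs_ballP[s /= s0 sO] : nbhs z1 O by exact: open_nbhs_nbhs.
  (* The order on C is partial, so this replaces min r s. *)
  pose t : C := (r^-1 + s^-1)^-1.
  have t0 : 0 < t by rewrite invr_gt0 addr_gt0 ?invr_gt0.
  have tr : t <= r by rewrite invf_ple ?posrE ?addr_gt0 ?invr_gt0 // lerDl invr_ge0 ltW.
  have ts : t <= s by rewrite invf_ple ?posrE ?addr_gt0 ?invr_gt0 // lerDr invr_ge0 ltW.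
  have tO w : `|w| < t -> O (w + z1).
    move=> wt; apply: sO; rewrite -ball_normE /= opprD addrCA subrr addr0 normrN.
    exact: lt_le_trans ts.
  apply: filterS (near_dist_lt z1 t0) => z zt; split.
    by rewrite -[z](subrK z1); exact: tO.
  rewrite /= -fz1 -[z](subrK z1) -[z1 in RHS]add0r.
  apply: (@power_series_max_modulus _ a (fun w => f (w + z1)) t) => // w wt.
    by apply: fE; exact: lt_le_trans tr.
  by rewrite add0r fz1; apply: fmax; exact: tO.
(* Relatively closed: by continuity, the points of [O] where [f] differs from [f z0] form an open
   set. *)
- exists (~` (O `&` [set z | f z != f z0])).
    apply: open_closedC; rewrite openE => z1 [Oz1 /= fz1].
    near=> z; split; first by near: z; exact: open_nbhs_nbhs.
    apply/negP => /eqP fz; have : `|f z - f z1| < `|f z1 - f z0|.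
      near: z; apply: analytic_on_near_lt fO Oz1 _ _.
      by rewrite normr_gt0 subr_eq0.
    by rewrite fz distrC ltxx.
  apply/seteqP; split => z [Oz] /=.
    by move=> fz; split => // -[_]; rewrite fz eqxx.
  move=> fz; split => //=; apply: contrapT => fzN; apply: fz.
  by split => //; apply/eqP.
Unshelve. all: by end_near. Qed.

End Analytic.

(** * Unitary matrices and characteristic polynomials *)

Section LinearAlgebra.
Variable R : realType.
Local Notation C := R[i].

Lemma adjmxE n (A : 'M[C]_n) : adjmx A = A^t*.
Proof. by []. Qed.

Lemma trmxC_mul m n p (A : 'M[C]_(m, n)) (B : 'M[C]_(n, p)) :
  (A *m B)^t* = B^t* *m A^t*.
Proof. by rewrite trmx_mul map_mxM. Qed.

Lemma unitarymx_mulVmx n (P : 'M[C]_n) : P \is unitarymx -> P^t* *m P = 1%:M.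
Proof. by move=> Pu; rewrite -[P^t*]mul1mx mulmxKtV. Qed.

Lemma char_poly_unitary_conj n (P A : 'M[C]_n) : P \is unitarymx ->
  char_poly (P^t* *m A *m P) = char_poly A.
Proof.
move=> Pu; rewrite /char_poly /char_poly_mx.
have -> : 'X%:M - map_mx polyC (P^t* *m A *m P) =
    map_mx polyC (P^t*) *m ('X%:M - map_mx polyC A) *m map_mx polyC P.
  rewrite mulmxBr mulmxBl !map_mxM; congr (_ - _).
  by rewrite scalar_mxC -mulmxA -map_mxM unitarymx_mulVmx // map_mx1 mulmx1.
rewrite !det_mulmx mulrAC -det_mulmx -map_mxM unitarymx_mulVmx //.
by rewrite map_mx1 det1 mul1r.
Qed.

Lemma char_poly_diag n (d : 'rV[C]_n) :
  char_poly (diag_mx d) = \prod_(x <- [seq d 0 i | i <- enum 'I_n]) ('X - x%:P).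
Proof.
rewrite char_poly_trig ?diag_mx_is_trig // big_map big_enum /=.
by apply: eq_bigr => i _; rewrite mxE eqxx.
Qed.

(** * Singular values from the characteristic polynomial *)

Lemma char_poly_factor n (A : 'M[C]_n) :
  exists rs, char_poly A = \prod_(x <- rs) ('X - x%:P).
Proof.
have [rs rsE] := closed_field_poly_normal (char_poly A).
by exists rs; rewrite rsE (monicP (char_poly_monic A)) scale1r.
Qed.

(** The root list picked by [xget] is arbitrary, but any two factorizations agree up to permutation
    and sorting removes the difference. *)
Lemma sing_vals_char_poly n (A : 'M[C]_n) rs :
  char_poly (adjmx A *m A) = \prod_(x <- rs) ('X - x%:P) ->
  sing_vals A = [seq Num.sqrt x | x <- sort >=%R [seq complex.Re x | x <- rs]].
Proof.
move=> rsE; rewrite /sing_vals /eigenvalues_seq.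
case: xgetP => [rs' _ /= rs'E|/(_ rs)//].
congr map; apply/perm_sortP.
- by move=> x y; exact: le_total.
- by move=> y x z /= yx zy; exact: le_trans yx.
- by move=> x y /andP[xy yx]; apply/le_anti/andP.
- by apply/perm_map/prod_XsubC_eq; rewrite -rsE -rs'E.
Qed.

(** In the Gram matrix of [P *m A *m Q] the factor [P] cancels and [Q] acts by unitary
    conjugation. *)
Lemma sing_vals_unitary n (P A Q : 'M[C]_n) : P \is unitarymx -> Q \is unitarymx ->
  sing_vals (P *m A *m Q) = sing_vals A.
Proof.
move=> Pu Qu; have [rs rsE] := char_poly_factor (adjmx A *m A).
rewrite (sing_vals_char_poly rsE); apply: sing_vals_char_poly.
rewrite -rsE !adjmxE !trmxC_mul -(char_poly_unitary_conj (A^t* *m A) Qu) !mulmxA.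
by rewrite mulmxKtV.
Qed.

(** Gram-Schmidt is run on the matrix all of whose rows are [u]. Its first output row [p] satisfies
    [u = a *: p] with [a >= 0]; both have norm 1, so [a = 1]. *)
Lemma unitarymx_row0 n (u : 'rV[C]_n.+1) : u *m u^t* = 1%:M ->
  exists2 P : 'M[C]_n.+1, P \is unitarymx & row 0 P = u.
Proof.
move=> u1; pose A : 'M[C]_n.+1 := \matrix_(i, j) u 0 j.
have A0 : row 0 A = u by apply/rowP => j; rewrite !mxE.
have Pu := @schmidt_unitarymx _ _ _ A (leqnn _).
exists (schmidt A) => //.
have := form1_row_schmidt A 0; rewrite A0; set p := row 0 _ => up_ge0.
have p1 : p *m p^t* = 1%:M.
  by move/row_unitarymxP : Pu => /(_ 0 0); rewrite dotmxE eqxx => pp;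
     apply/matrixP => i j; rewrite !ord1 pp mxE.
have : (row 0 A <= <<p>>)%MS.
  apply: submx_trans (row_schmidt_sub A 0) _; apply/sumsmx_subP => k.
  by rewrite leqn0 => /eqP k0; rewrite (_ : k = 0) //; apply/val_inj.
rewrite A0 genmxE => /sub_rVP [a ua].
suff a1 : a = 1 by rewrite ua a1 scale1r.
have a_ge0 : 0 <= a.
  by move: up_ge0; rewrite dotmxE ua -scalemxAl p1 !mxE mulr1.
have : a ^+ 2 = 1.
  have /matrixP/(_ 0 0) := u1.
  rewrite ua -scalemxAl linearZ /= map_mxZ -scalemxAr p1 !mxE /= mulr1.
  by rewrite (CrealP _) ?ger0_real.
by move/eqP; rewrite sqrf_eq1 => /predU1P[->//|/eqP aN1]; move: a_ge0; rewrite aN1 ler0N1.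
Qed.

(** * Spectral decomposition of the Gram matrix and the largest singular value *)

Lemma ge0_complexE (x : C) : 0 <= x -> x = (complex.Re x)%:C%C.
Proof. by case: x => a b; rewrite lecE /= => /andP[/eqP -> _]. Qed.

Lemma gram_diag_entry m n (B : 'M[C]_(m, n)) i :
  (B^t* *m B) i i = \sum_k `|B k i| ^+ 2.
Proof. by rewrite mxE; apply: eq_bigr => k _; rewrite !mxE mulrC -normCK. Qed.

Lemma gram_spectral n (A : 'M[C]_n) : exists (P : 'M[C]_n) (d : 'I_n -> R),
  [/\ P \is unitarymx, forall i, 0 <= d i &
      A^t* *m A = P^t* *m diag_mx (\row_i (d i)%:C%C) *m P].
Proof.
pose H := A^t* *m A; have Ht : H^t* = H by rewrite /H trmxC_mul trmxCK.
have /orthomx_spectralP : H \is normalmx by apply/normalmxP; rewrite Ht.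
set P := spectralmx H; set sp := spectral_diag H.
have Pu : P \is unitarymx by exact: spectral_unitarymx.
rewrite invmx_unitary // => HE.
(* The eigenvalues are the squared column norms of [A *m P^t*]. *)
have sp_ge0 i : 0 <= sp 0 i.
  have -> : sp 0 i = ((A *m P^t*)^t* *m (A *m P^t*)) i i.
    rewrite trmxC_mul trmxCK mulmxA -[P *m _ *m A]mulmxA -/H HE !mulmxA mulmxtVK //.
    by rewrite (unitarymxP Pu) mul1mx mxE eqxx.
  by rewrite gram_diag_entry sumr_ge0 // => k _; rewrite exprn_ge0.
exists P, (fun i => complex.Re (sp 0 i)); split => // [i|].
  by rewrite -lecR -ge0_complexE.
rewrite -/H HE; congr (_ *m diag_mx _ *m _).
by apply/rowP => i; rewrite mxE -ge0_complexE.
Qed.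

(** The head of the sorted list of eigenvalues dominates the others; [i0] is an index at which it
    occurs. *)
Lemma sing_val_top_spectral n (A : 'M[C]_n.+1) :
  exists (P : 'M[C]_n.+1) (d : 'I_n.+1 -> R) i0,
  [/\ P \is unitarymx, A^t* *m A = P^t* *m diag_mx (\row_i (d i)%:C%C) *m P,
      forall i, 0 <= d i <= d i0 & d i0 = sing_val A 0 ^+ 2].
Proof.
have [P [d [Pu d0 AE]]] := gram_spectral A.
have := @sing_vals_char_poly _ A [seq (d i)%:C%C | i <- enum 'I_n.+1].
rewrite adjmxE AE char_poly_unitary_conj // char_poly_diag.
rewrite (eq_map (_ : _ =1 (fun i => (d i)%:C%C))) => [|i]; last by rewrite mxE.
move=> /(_ erefl); rewrite -map_comp /= => sE.
pose s := sort >=%R [seq d i | i <- enum 'I_n.+1].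
have s_mem i : d i \in s by rewrite mem_sort map_f // mem_enum.
have s_sorted : sorted >=%R s by apply: sort_sorted => x y; exact: le_total.
have sA : sing_vals A = [seq Num.sqrt x | x <- s] by rewrite sE.
have [h [s' s_eq]] : exists h s', s = h :: s'.
  by move: (s_mem 0); case: (s) => // h s' _; exists h, s'.
move: s_sorted; rewrite s_eq /= path_sortedE; last first.
  by move=> y x z /= yx zy; exact: le_trans yx.
move=> /andP[/allP hs _]; rewrite s_eq in s_mem sA.
have /mapP[i0 _ hi0] : h \in [seq d i | i <- enum 'I_n.+1].
  by rewrite -(mem_sort >=%R) -/s s_eq mem_head.
exists P, d, i0; split => //.
  move=> i; rewrite d0 /=; have := s_mem i; rewrite in_cons -hi0 => /predU1P[->//|].
  exact: hs.
by rewrite /sing_val sA /= hi0 sqr_sqrtr.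
Qed.

Lemma sing_val_ge0 n (A : 'M[C]_n) k : 0 <= sing_val A k.
Proof.
rewrite /sing_val /sing_vals; set s := sort _ _.
have [ks|ks] := ltnP k (size s); first by rewrite (nth_map 0) // sqrtr_ge0.
by rewrite nth_default // size_map.
Qed.

(** With [y = P *m x] in the eigenbasis, the left side is the sum of [d i * |y i|^2], while [x] and
    [y] have the same norm. *)
Lemma sing_val_top_bound n (A : 'M[C]_n.+1) (x : 'cV[C]_n.+1) :
  \sum_i `|(A *m x) i 0| ^+ 2 <= (sing_val A 0)%:C%C ^+ 2 * \sum_i `|x i 0| ^+ 2.
Proof.
have [P [d [i0 [Pu AE d0 di0]]]] := sing_val_top_spectral A.
have -> : (sing_val A 0)%:C%C ^+ 2 = (d i0)%:C%C by rewrite di0 rmorphXn.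
rewrite -!gram_diag_entry trmxC_mul mulmxA -[x^t* *m _ *m A]mulmxA AE.
have -> : x^t* *m x = (P *m x)^t* *m (P *m x).
  by rewrite trmxC_mul mulmxA mulmxKtV.
rewrite gram_diag_entry mulr_sumr !mulmxA -trmxC_mul -mulmxA mxE.
apply: ler_sum => i _; rewrite mul_mx_diag !mxE mulrAC.
rewrite [_^* * _]mulrC -normCK mulrC ler_wpM2r ?exprn_ge0 // lecR.
by have /andP[] := d0 i.
Qed.

(** A unit eigenvector [v] for the top eigenvalue and a matching unit vector [u] satisfy
    [u A v^* = s]; they become the first row of [P] and, after adjunction, the first column of
    [Q]. *)
Lemma sing_val_top_attained n (A : 'M[C]_n.+1) : exists P Q : 'M[C]_n.+1,
  [/\ P \is unitarymx, Q \is unitarymx & (P *m A *m Q) 0 0 = (sing_val A 0)%:C%C].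
Proof.
have [U [d [i0 [Uu AE _ di0]]]] := sing_val_top_spectral A.
pose v := row i0 U; set s := sing_val A 0 in di0 *.
have v1 : v *m v^t* = 1%:M.
  move/row_unitarymxP : Uu => /(_ i0 i0); rewrite dotmxE eqxx => vv.
  by apply/matrixP => i j; rewrite !ord1 vv mxE.
have vAE : v *m (A^t* *m A) = (s ^+ 2)%:C%C *: v.
  rewrite AE !mulmxA /v -row_mul (unitarymxP Uu) -row_mul mul1mx.
  by rewrite row_diag_mx !mxE di0 -scalemxAl -rowE.
have [u u1 uA] : exists2 u : 'rV[C]_n.+1, u *m u^t* = 1%:M &
    u *m A *m v^t* = s%:C%C%:M.
  (* If [s = 0] then [A] kills [v^t*] and any unit [u] would do; otherwise [u] is [v *m A^t*]
     divided by its norm [s]. *)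
  have [s0|sN0] := eqVneq s 0.
    exists v => //; rewrite s0 -mulmxA (_ : A *m v^t* = 0).
      by rewrite mulmx0 [RHS]raddf0.
    have := sing_val_top_bound A (v^t*); rewrite -/s s0 expr0n /= mul0r => Av0.
    have /psumr_eq0P Av : \sum_i `|(A *m v^t*) i 0| ^+ 2 = 0.
      by apply/le_anti; rewrite Av0 sumr_ge0 // => i _; rewrite exprn_ge0.
    apply/matrixP => i j; rewrite ord1 [RHS]mxE; apply/eqP.
    by rewrite -normr_eq0 -sqrf_eq0 Av // => k _; rewrite exprn_ge0.
  have sC : s%:C%C != 0 :> C by rewrite fmorph_eq0.
  exists (s%:C%C^-1 *: (v *m A^t*)); last first.
    rewrite -!scalemxAl -[v *m _ *m A]mulmxA vAE -scalemxAl v1 scalerA scalemx1.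
    by rewrite rmorphXn expr2 mulKf.
  rewrite -scalemxAl linearZ /= map_mxZ trmxC_mul trmxCK -scalemxAr.
  rewrite mulmxA -[v *m _ *m A]mulmxA vAE -scalemxAl v1 !scalerA scalemx1.
  rewrite /= (CrealP _) ?rpredV ?ger0_real // -?[0]/(0%:C%C) ?lecR ?sing_val_ge0 //.
  by rewrite rmorphXn expr2 mulKf // mulVf.
have [P Pu P0] := unitarymx_row0 u1; have [Q Qu Q0] := unitarymx_row0 v1.
exists P, (Q^t*); split; [exact: Pu | by rewrite trmxC_unitary |].
have /matrixP/(_ 0 0) := uA; rewrite [RHS]mxE eqxx mulr1n => <-.
rewrite -P0 -Q0 -!row_mul !mxE; apply: eq_bigr => i _.
by rewrite !mxE.
Qed.

(** * Columns, rows and entries against the largest singular value *)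

Lemma col_sing_val_bound n (B : 'M[C]_n.+1) j :
  \sum_i `|B i j| ^+ 2 <= (sing_val B 0)%:C%C ^+ 2.
Proof.
have := sing_val_top_bound B (delta_mx j 0).
rewrite (eq_bigr (fun i => `|B i j| ^+ 2)); last first.
  by move=> i _; rewrite -colE mxE.
move/le_trans; apply.
rewrite (bigD1 j) //= big1 ?addr0 => [|i ij]; last first.
  by rewrite mxE (negbTE ij) normr0 expr0n.
by rewrite mxE !eqxx normr1 expr1n mulr1.
Qed.

(** Applying [B] to the adjoint of its row [i] gives [S] in position [i], so [S^2 <= s_1^2 * S], and
    [S] cancels. No comparison with the singular values of the adjoint is needed. *)
Lemma row_sing_val_bound n (B : 'M[C]_n.+1) i :
  \sum_j `|B i j| ^+ 2 <= (sing_val B 0)%:C%C ^+ 2.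
Proof.
set S := \sum_j _; have S0 : 0 <= S by apply: sumr_ge0 => j _; rewrite exprn_ge0.
have [->|SN0] := eqVneq S 0.
  by rewrite exprn_ge0 // -[0]/(0%:C%C) lecR sing_val_ge0.
have := sing_val_top_bound B ((row i B)^t*).
have -> : \sum_j `|((row i B)^t*) j 0| ^+ 2 = S.
  by apply: eq_bigr => j _; rewrite !mxE norm_conjC.
have Bi : (B *m (row i B)^t*) i 0 = S.
  by rewrite mxE; apply: eq_bigr => j _; rewrite !mxE -normCK.
rewrite (bigD1 i) //= Bi => SS.
have : `|S| ^+ 2 <= (sing_val B 0)%:C%C ^+ 2 * S.
  apply: le_trans SS; rewrite lerDl; apply: sumr_ge0 => j _.
  by rewrite exprn_ge0.
by rewrite ger0_norm // expr2 ler_pM2r // lt_neqAle eq_sym SN0.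
Qed.

Lemma norm_entry_le_sing_val n (B : 'M[C]_n.+1) i j :
  `|B i j| <= (sing_val B 0)%:C%C.
Proof.
rewrite -(ler_pXn2r (ltn0Sn 1)) ?nnegrE //; last first.
  by rewrite -[0]/(0%:C%C) lecR sing_val_ge0.
have := col_sing_val_bound B j; apply: le_trans.
rewrite (bigD1 i) //= lerDl; apply: sumr_ge0 => k _.
by rewrite exprn_ge0.
Qed.

(** * Splitting off the largest singular value *)

Lemma sum_norm_sqr_le_first n (x : 'I_n.+1 -> C) (c : C) :
  0 <= c -> x 0 = c -> \sum_i `|x i| ^+ 2 <= c ^+ 2 ->
  forall i, x (lift 0 i) = 0.
Proof.
move=> c0 xc; rewrite big_ord_recl xc ger0_norm // gerDl => xle i.
have x_ge0 k : 0 <= `|x (lift 0 k)| ^+ 2 by rewrite exprn_ge0.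
have : `|x (lift 0 i)| ^+ 2 <= 0.
  apply: le_trans xle; rewrite (bigD1 i) //= lerDl.
  by apply: sumr_ge0 => k _.
move=> xi; apply/eqP; rewrite -normr_eq0 -sqrf_eq0; apply/eqP/le_anti.
by rewrite xi x_ge0.
Qed.

Lemma sing_val_top_split n (B : 'M[C]_(1 + n)) :
  B 0 0 = (sing_val (B : 'M[C]_n.+1) 0)%:C%C ->
  B = block_mx (B 0 0)%:M 0 0 (drsubmx B).
Proof.
move=> B00; have c0 : 0 <= (sing_val (B : 'M[C]_n.+1) 0)%:C%C :> C.
  by rewrite -[0]/(0%:C%C) lecR sing_val_ge0.
rewrite -[LHS]submxK; congr block_mx; apply/matrixP => i j.
- rewrite !ord1 !mxE eqxx; congr (B _ _); exact/val_inj.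
- rewrite !ord1 !mxE; have := sum_norm_sqr_le_first c0 B00.
  move=> /(_ (row_sing_val_bound _ _) j) <-.
  by congr (B _ _); apply/val_inj.
- rewrite !ord1 !mxE.
  have := @sum_norm_sqr_le_first n (fun i => B i 0) _ c0 B00.
  move=> /(_ (col_sing_val_bound _ _) i) <-.
  by congr (B _ _); apply/val_inj.
Qed.

Lemma char_poly_block_scalar n (a : C) (H : 'M[C]_n) :
  char_poly (block_mx a%:M 0 0 H : 'M[C]_(1 + n)) = ('X - a%:P) * char_poly H.
Proof.
rewrite /char_poly /char_poly_mx map_block_mx !map_mx0 scalar_mx_block.
rewrite opp_block_mx add_block_mx !oppr0 !addr0 det_ublock.
by rewrite det_mx11 !mxE !eqxx !mulr1n.
Qed.

(** The Gram matrix of [B] has the eigenvalues of that of [G] and [c^2]. As [c] is the largest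
    singular value of [B], sorting puts [c^2] first and leaves the sorted list for [G] behind it. *)
Lemma sing_vals_block n (c : R) (G : 'M[C]_n) (B : 'M[C]_(1 + n)) :
  B = block_mx c%:C%C%:M 0 0 G -> sing_val (B : 'M[C]_n.+1) 0 = c ->
  sing_vals (B : 'M[C]_n.+1) = c :: sing_vals G.
Proof.
move=> B_def Bc.
have c0 : 0 <= c by rewrite -Bc sing_val_ge0.
have [P [d [Pu d0 GE]]] := gram_spectral G.
pose rs := [seq (d i)%:C%C | i <- enum 'I_n].
have rsE : char_poly (adjmx G *m G) = \prod_(x <- rs) ('X - x%:P).
  rewrite adjmxE GE char_poly_unitary_conj // char_poly_diag; congr bigop.
  by apply: eq_map => i; rewrite mxE.
have BE : char_poly (adjmx B *m B) =
    \prod_(x <- (c ^+ 2)%:C%C :: rs) ('X - x%:P).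
  rewrite big_cons -rsE -char_poly_block_scalar; congr char_poly.
  rewrite B_def !adjmxE tr_block_mx map_block_mx !trmx0 !map_mx0 tr_scalar_mx.
  rewrite map_scalar_mx mulmx_block !mulmx0 !mul0mx !addr0 !add0r.
  congr block_mx; rewrite -scalar_mxM; congr (_%:M).
  by rewrite rmorphXn /= (CrealP _) ?ger0_real // -[0]/(0%:C%C) lecR.
move: Bc; rewrite /sing_val (sing_vals_char_poly BE) (sing_vals_char_poly rsE).
pose t := [seq d i | i <- enum 'I_n].
have t0 x : x \in t -> 0 <= x by move=> /mapP[i _ ->].
rewrite map_cons (_ : map _ rs = t) /=; last by rewrite -map_comp.
set u := sort _ (_ :: _) => uc.
have u_perm : perm_eq u (c ^+ 2 :: t) by rewrite perm_sort.
have u_sorted : sorted >=%R u by apply: sort_sorted => x y; exact: le_total.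
case: u uc u_perm u_sorted => [|h u] /= hc u_perm u_sorted.
  by have := perm_size u_perm.
(* [Num.sqrt] is 0 on negative reals, so [c = sqrt h] determines [h = c^2] only once [h >= 0]. *)
have h0 : 0 <= h.
  have : h \in c ^+ 2 :: t by rewrite -(perm_mem u_perm) mem_head.
  by rewrite in_cons => /predU1P[->|/t0//]; rewrite exprn_ge0.
rewrite hc; congr (_ :: map _ _); apply: (sorted_eq (leT := >=%R)).
- by move=> y x z /= yx zy; exact: le_trans yx.
- by move=> x y /andP[xy yx]; apply/le_anti/andP.
- exact: path_sorted u_sorted.
- by apply: sort_sorted => x y; exact: le_total.
- by rewrite perm_sym perm_sort perm_sym -(perm_cons (c ^+ 2)) -{1}hc sqr_sqrtr.
Qed.

End LinearAlgebra.

(** * The induction on the size of the matrix *)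

Lemma mx_analytic_on_mul (R : realType) n (O : set (CC R)) (F : CC R -> 'M[CC R]_n)
    (P Q : 'M[CC R]_n) :
  mx_analytic_on O F -> mx_analytic_on O (fun z => P *m F z *m Q).
Proof.
move=> FO i j.
have -> : (fun z => (P *m F z *m Q) i j) =
    (fun z => \sum_k Q k j * \sum_l P i l * F z l k).
  by apply/funext => z; rewrite mxE; apply: eq_bigr => k _; rewrite mxE mulrC.
apply: analytic_on_sum => k; apply: analytic_on_scale.
by apply: analytic_on_sum => l; apply: analytic_on_scale.
Qed.

Theorem theorem5 (R : realType) (n : nat) (O : set (CC R))
    (F : CC R -> 'M[CC R]_n) :
  region O ->
  mx_analytic_on O F ->
  (forall k : 'I_n, exists2 zk, O zk &
      forall z, O z -> sing_val (F z) k <= sing_val (F zk) k) ->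
  forall z w, O z -> O w -> F z = F w.
Proof.
move=> regO; elim: n F => [|n IHn] F FO Fmax z w Oz Ow.
  by apply/matrixP => -[].
have [z1 Oz1 z1max] := Fmax 0; set c := sing_val (F z1) 0 in z1max.
have [P [Q [Pu Qu PQ]]] := sing_val_top_attained (F z1).
pose B x : 'M[CC R]_(1 + n) := P *m F x *m Q.
have BO : mx_analytic_on O B by exact: mx_analytic_on_mul.
have sB x : sing_vals (B x : 'M[CC R]_n.+1) = sing_vals (F x).
  exact: sing_vals_unitary.
have sB0 x : sing_val (B x : 'M[CC R]_n.+1) 0 = sing_val (F x) 0.
  by rewrite /sing_val sB.
have B_le x : `|B x 0 0| <= (sing_val (F x) 0)%:C%C.
  by rewrite -sB0; exact: norm_entry_le_sing_val.
have Bz1 : B z1 0 0 = c%:C%C by [].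
have c0 : 0 <= c%:C%C :> CC R by rewrite -[0]/(0%:C%C) lecR sing_val_ge0.
have c_norm : `|c%:C%C : CC R| = c%:C%C by rewrite ger0_norm.
have Bc x : O x -> B x 0 0 = c%:C%C.
  rewrite -Bz1; apply: (max_modulus_principle regO (BO 0 0) Oz1) => y Oy.
  rewrite Bz1 c_norm.
  by apply: le_trans (B_le y) _; rewrite lecR z1max.
(* Squeeze: [c = |B x 0 0| <= s_1(F x) <= c]. The splitting at [x] needs this equality, not only the
   constant corner. *)
have sc x : O x -> sing_val (F x) 0 = c.
  move=> Ox; have := B_le x; rewrite (Bc _ Ox) c_norm lecR => cs.
  apply: le_anti; apply/andP; split; [exact: z1max | exact: cs].
pose G x : 'M[CC R]_n := drsubmx (B x).
have BE x : O x -> B x = block_mx c%:C%C%:M 0 0 (G x).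
  move=> Ox; rewrite -(Bc _ Ox); apply: sing_val_top_split.
  by rewrite sB0 (sc _ Ox) (Bc _ Ox).
(* Dropping the head [c] shifts the index by one, so each maximum assumed for [F] at [lift 0 k]
   serves [G] at [k]. *)
have sG x k : O x -> sing_val (G x) k = sing_val (F x) (lift 0 k).
  move=> Ox; have := sing_vals_block (BE _ Ox).
  by rewrite sB0 (sc _ Ox) sB /sing_val => /(_ erefl) ->.
have GE : G z = G w.
  apply: IHn Oz Ow.
    move=> i j.
    have -> : (fun x => G x i j) = (fun x => B x (rshift 1 i) (rshift 1 j)).
      by apply/funext => x; rewrite [LHS]mxE [LHS]mxE.
    exact: BO.
  move=> k; have [y Oy ymax] := Fmax (lift 0 k).
  exists y; first exact: Oy.
  by move=> x Ox; rewrite (sG _ _ Ox) (sG _ _ Oy); exact: ymax.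
have : B z = B w by rewrite (BE _ Oz) (BE _ Ow) GE.
(* [P] and [Q] do not depend on the point, so they can be undone on both sides. *)
rewrite /B => /(congr1 (fun X => P^t* *m X *m Q^t*)).
by rewrite !mulmxA !(mulmxtVK _ Qu) (unitarymx_mulVmx Pu) !mul1mx.
Qed.
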